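(* Let $G=(V,E)$ be an infinite, connected, simple graph with bounded maximum degree, let the initial water levels $\{\eta_0(u)\}_{u\in V}$ be i.i.d. random variables uniformly distributed on $[0,1]$, and let $v\in V$ be a fixed vertex. Let $\kappa_G(v)$ denote the supremum of water levels achievable at $v$ by finite move sequences, starting from the initial profile. If $G$ contains a neighbor-rich half-line, then $\kappa_G(v)=1$ almost surely.
   Context: All graphs are undirected; simple means having neither loops nor multiple edges; $\langle x,y\rangle$ denotes the edge between $x$ and $y$; $\mathbb{N}=\{1,2,\dots\}$ and $\mathbb{N}_0=\{0,1,2,\dots\}$. Water transport. Given an initial water profile $\{\eta_0(u)\}_{u\in V}\in[0,1]^V$, a move is a pair $(e,\mu)\in E\times(0,\tfrac12]$. A finite sequence of moves $(e_1,\mu_1),\dots,(e_T,\mu_T)$, $T\in\mathbb{N}_0$, produces profiles $\eta_1,\dots,\eta_T$ recursively: if $e_k=\langle x,y\rangle$, $\eta_{k-1}(x)=a$ and $\eta_{k-1}(y)=b$, then $$\eta_k(x)=a+\mu_k(b-a),\qquad \eta_k(y)=b+\mu_k(a-b),$$ and $\eta_k(w)=\eta_{k-1}(w)$ for all $w\in V\setminus\{x,y\}$. For $v\in V$, $$\kappa_G(v):=\sup\{r\ge 0:\ \text{there exist } T\in\mathbb{N}_0 \text{ and a move sequence of length } T \text{ such that } \eta_T(v)=r\}.$$ The move sequence may be chosen depending on the initial profile. When the initial profile is random, $\kappa_G(v)$ is a random variable. Neighbor-rich half-line. An infinite, connected, simple graph $G=(V,E)$ contains a neighbor-rich half-line if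 there exist a subgraph of $G$ consisting of a half-line $H=(\{v_n: n\in\mathbb{N}\},\{\langle v_n,v_{n+1}\rangle: n\in\mathbb{N}\})$ (with the $v_n$ pairwise distinct), pairwise distinct vertices $\{u_n: n\in\mathbb{N}\}$ from $V\setminus\{v_n: n\in\mathbb{N}\}$, and an injective function $f:\mathbb{N}\to\mathbb{N}$ such that: (i) $\langle u_n,v_{f(n)}\rangle\in E$ for all $n\in\mathbb{N}$; (ii) $\sum_{n=1}^\infty \frac{1}{f(n)}$ diverges. *)

(* Defs.v *)
From Stdlib Require Export Relations.
From HB Require Export structures.
From mathcomp Require Export all_boot all_order all_algebra finmap.
From mathcomp Require Export all_classical all_reals all_analysis.
Export Order.TTheory GRing.Theory Num.Theory.
Export numFieldNormedType.Exports.

Set Implicit Arguments.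
Unset Strict Implicit.
Unset Printing Implicit Defensive.

Local Open Scope classical_set_scope.
Local Open Scope ring_scope.

Record simple_graph (V : Type) := SimpleGraph {
  adj : V -> V -> Prop;
  adj_sym : forall x y, adj x y -> adj y x;
  adj_irrefl : forall x, ~ adj x x
}.

Definition connected_graph (V : Type) (G : simple_graph V) : Prop :=
  forall x y, clos_refl_trans V (adj G) x y.

Definition bounded_degree (V : Type) (G : simple_graph V) : Prop :=
  exists D : nat, forall x, ([set y | adj G x y] #<= `I_D)%card.

(* The natural numbers of the definition start at 1: [v n], [u n] and [f n]
   stand for $v_{n+1}$, $u_{n+1}$ and $f(n+1) - 1$ respectively, hence the
   successor in the terms of the series. *)
Definition has_neighbor_rich_half_line (R : realType) (V : Type)
    (G : simple_graph V) : Prop :=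
  exists (v u : nat -> V) (f : nat -> nat),
    [/\ injective v /\ (forall n, adj G (v n) (v n.+1)),
        injective u /\ (forall m n, u m <> v n),
        injective f,
        forall n, adj G (u n) (v (f n)) &
        ~ cvgn (series (fun n => (f n).+1%:R^-1 : R))].

(* The edge is given with an orientation, which does not affect [apply_move]. *)
Record move (R : realType) (V : Type) (G : simple_graph V) := Move {
  move_fst : V;
  move_snd : V;
  move_coef : R;
  move_edge : adj G move_fst move_snd;
  move_coef_itv : 0 < move_coef <= 2^-1
}.

Definition apply_move (R : realType) (V : choiceType) (G : simple_graph V)
    (eta : V -> R) (m : move R G) : V -> R :=
  let x := move_fst m in let y := move_snd m in let mu := move_coef m in
  fun w => if w == x then eta x + mu * (eta y - eta x)
           else if w == y then eta y + mu * (eta x - eta y)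
           else eta w.

Definition profile_after (R : realType) (V : choiceType) (G : simple_graph V)
    (eta0 : V -> R) (ms : seq (move R G)) : V -> R :=
  foldl (@apply_move R V G) eta0 ms.

(* Extended-real supremum: a uniform random variable lies in [0, 1] only almost
   surely, so the achievable levels may be unbounded on a null event. *)
Definition kappa (R : realType) (V : choiceType) (G : simple_graph V)
    (eta0 : V -> R) (v : V) : \bar R :=
  ereal_sup [set r%:E | r in
    [set r : R | 0 <= r /\
                 exists ms : seq (move R G), profile_after eta0 ms v = r]].

Definition independent_RVs (d : measure_display) (Omega : measurableType d)
    (R : realType) (P : probability Omega R) (I : choiceType)
    (X : I -> {RV P >-> R}) : Prop :=
  forall (J : {fset I}) (A : I -> set R),
    (forall i, i \in J -> measurable (A i)) ->
    P (\bigcap_(i in [set` J]) X i @^-1` A i) =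
    (\prod_(i <- J) P (X i @^-1` A i))%E.

Definition uniform01 (d : measure_display) (Omega : measurableType d)
    (R : realType) (P : probability Omega R) (X : {RV P >-> R}) : Prop :=
  forall A : set R, measurable A ->
    distribution P X A = uniform_prob (@ltr01 R) A.

(* Main.v *)
(** Join [v] to the half-line by a walk [W].  If all levels on [W], [v_0], ...,
    [v_(f n)] are at least [a] and the node [u_n] has level at least [c > a], then
    nearly equalizing these [k = O(f n)] vertices lifts all of them to at least
    [a + (c - a) / (2 k)].  Treating several such nodes by decreasing [f n]
    multiplies the deficit [c - a] by the product of the factors [1 - 1 / (2 k)].
    For [c < 1] the nodes with initial level at least [c] form an independent
    thinning; by independence the expectation of the random product is the product
    of the expectations, which tends to [0] because the sum of [1 / f n] diverges.
    Hence the deficit is almost surely arbitrarily small. *)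

Require Import Defs.
From mathcomp Require Import measurable_realfun ring lra zify.

Set Implicit Arguments.
Unset Strict Implicit.
Unset Printing Implicit Defensive.

Local Open Scope classical_set_scope.
Local Open Scope ring_scope.

(** * Averaging moves on a finite set of vertices *)

Section Deterministic.
Variables (R : realType) (V : choiceType) (G : simple_graph V).
Implicit Types (eta : V -> R) (s : seq V).

Definition adjb (x y : V) : bool := `[< adj G x y >].

Lemma half_coef_itv : 0 < (2^-1 : R) <= 2^-1.
Proof. by rewrite invr_gt0 ltr0n lexx. Qed.

Definition half_move (x y : V) (xy : adj G x y) : move R G :=
  Move xy half_coef_itv.

Lemma adj_neq (x y : V) : adj G x y -> x != y.
Proof. by move=> xy; apply/eqP => e; subst y; exact: (adj_irrefl xy). Qed.

(** Taking [g] to be the identity gives conservation of the total; taking it to be the square gives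
    the loss of energy. *)
Lemma sum_apply_half_move (g : R -> R) eta s (x y : V) (xy : adj G x y) :
  uniq s -> x \in s -> y \in s ->
  \sum_(z <- s) g (apply_move eta (half_move xy) z) =
  \sum_(z <- s) g (eta z)
    + (2 * g ((eta x + eta y) / 2) - g (eta x) - g (eta y)).
Proof.
move=> us xs ys; have neq := adj_neq xy.
have rest (h : V -> R) : \sum_(z <- s) h z =
    h x + h y + \sum_(z <- s | (z != x) && (z != y)) h z.
  rewrite (bigD1_seq x)//= -addrA; congr (_ + _).
  rewrite -big_filter (bigD1_seq y)/= ?filter_uniq ?mem_filter 1?eq_sym ?neq//.
  by congr (_ + _); rewrite big_filter_cond.
rewrite (rest (fun z => g (apply_move _ _ z))) (rest (fun z => g (eta z))) /=.
rewrite (eq_bigr (fun z => g (eta z))); last first.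
  by move=> z /andP[zx zy]; rewrite /apply_move /= (negbTE zx) (negbTE zy).
rewrite /apply_move /= eqxx eq_sym (negbTE neq) eqxx.
have -> : eta x + 2^-1 * (eta y - eta x) = (eta x + eta y) / 2 by field.
have -> : eta y + 2^-1 * (eta x - eta y) = (eta x + eta y) / 2 by field.
by ring.
Qed.

Lemma apply_move_notin eta s (m : move R G) :
  move_fst m \in s -> move_snd m \in s ->
  forall z, z \notin s -> apply_move eta m z = eta z.
Proof.
move=> xs ys z zs; rewrite /apply_move.
have -> : (z == move_fst m) = false by apply: contraNF zs => /eqP ->.
by have -> : (z == move_snd m) = false by apply: contraNF zs => /eqP ->.
Qed.

(* Averaging across an edge whose endpoints differ by more than [e] preserves
   the total and decreases the sum of squares by at least [e ^ 2 / 2]. *)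
Lemma equalize_edges s (e : R) eta : uniq s -> 0 < e ->
  exists ms : seq (move R G),
    [/\ forall z, z \notin s -> profile_after eta ms z = eta z,
        \sum_(z <- s) profile_after eta ms z = \sum_(z <- s) eta z &
        forall x y, x \in s -> y \in s -> adj G x y ->
          profile_after eta ms x <= profile_after eta ms y + e].
Proof.
move=> us e0.
(* Energy counted in units of [e ^+ 2 / 2]: every move made costs at least one unit, so induction on
   [n] terminates. *)
have [n] : exists n : nat, \sum_(z <- s) (eta z) ^+ 2 < n%:R * (e ^+ 2 / 2).
  exists (Num.truncn ((\sum_(z <- s) (eta z) ^+ 2) / (e ^+ 2 / 2))).+1.
  have h0 : 0 < e ^+ 2 / 2 by rewrite divr_gt0// exprn_gt0.
  rewrite -ltr_pdivrMr//. exact: truncnS_gt.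
elim: n eta => [|n IH] eta.
  by rewrite mul0r => /lt_geF/negP[]; apply: sumr_ge0 => z _; exact: sqr_ge0.
move=> hn.
have [[x [y [xs ys xy gap]]]|flat] := pselect (exists x y,
    [/\ x \in s, y \in s, adj G x y & eta y + e < eta x]); last first.
  exists [::]; split=> // x y xs ys xy; rewrite leNgt; apply/negP => gap.
  by apply: flat; exists x, y.
pose m := half_move xy; pose eta' := apply_move eta m.
have [|ms [off tot flat]] := IH eta'.
  rewrite (sum_apply_half_move (fun t => t ^+ 2) _ xy us xs ys).
  rewrite -natr1 mulrDl mul1r in hn.
  have : e ^+ 2 <= (eta x - eta y) ^+ 2.
    by apply: lerXn2r; rewrite ?nnegrE; lra.
  set S := \sum_(z <- s) _ in hn *; nra.
exists (m :: ms); split=> //=.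
- by move=> z zs; rewrite off//; exact: apply_move_notin zs.
- by rewrite tot (sum_apply_half_move id _ xy us xs ys); field.
Qed.

Lemma path_gap (h : V -> R) (e : R) (x : V) (p : seq V) :
  path (fun y z => `|h y - h z| <= e) x p ->
  forall y, y \in x :: p -> `|h x - h y| <= (size p)%:R * e.
Proof.
elim: p x => [|z p IH] x /=.
  by move=> _ y; rewrite inE => /eqP ->; rewrite subrr normr0 mul0r.
move=> /andP[xz zp] y; rewrite inE => /predU1P[->|yp].
  by rewrite subrr normr0 mulr_ge0// (le_trans _ xz).
rewrite -natr1 mulrDl mul1r [leRHS]addrC.
by rewrite (le_trans (ler_distD (h z) _ _))// lerD// IH.
Qed.

(** Let [N] be the length of [x :: p] and [D = (c - a) / (2 * N)]. The conserved average is at least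
    [a + (c - a) / N = a + 2 * D], and after equalization all levels on the path lie within [D] of
    each other, so none is below [a + D]. *)
Lemma raise_path (x : V) (p : seq V) (u : V) (a c : R) eta :
  path adjb x p -> u \in x :: p -> a < c ->
  (forall y, y \in x :: p -> a <= eta y) -> c <= eta u ->
  exists ms : seq (move R G),
    (forall z, z \notin x :: p -> profile_after eta ms z = eta z) /\
    (forall y, y \in x :: p ->
       a + (c - a) / (2 * (size (x :: p))%:R) <= profile_after eta ms y).
Proof.
move=> xp up ac ha hc.
(* The path may revisit vertices, so totals run over the duplicate-free [s], whose size is at most
   [N]. *)
set N := size (x :: p); set s := undup (x :: p).
have N0 : 0 < N%:R :> R by rewrite ltr0n.
have D0 : 0 < (c - a) / (2 * N%:R) by rewrite divr_gt0 ?subr_gt0// mulr_gt0.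
(* The tolerance per edge is [D / (2 * N)]: fewer than [N] edges separate a vertex from [x], which
   costs at most [D / 2], and two vertices are compared through [x]. *)
have e0 : 0 < (c - a) / (2 * N%:R) / (2 * N%:R) by rewrite divr_gt0// mulr_gt0.
have [ms [off tot flat]] := equalize_edges eta (undup_uniq (x :: p)) e0.
exists ms; split=> [z zs|y yp]; first by rewrite off// mem_undup.
set eta' := profile_after eta ms in off tot flat *.
set D := (c - a) / _ in D0 e0 flat *.
have near_x z : z \in x :: p -> `|eta' x - eta' z| <= (size p)%:R * (D / (2 * N%:R)).
  apply: path_gap.
  apply: (@sub_in_path _ (mem (x :: p))) xp; last exact/allP.
  move=> y1 y2 y1p y2p /asboolP yy; rewrite ler_distl lerBlDr.
  rewrite !flat ?mem_undup//; first exact: adj_sym.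
have close z : z \in x :: p -> eta' z <= eta' y + D.
  move=> zp; have := near_x _ zp; have := near_x _ yp.
  rewrite !ler_distl => /andP[? ?] /andP[? ?].
  have : (size p)%:R * (D / (2 * N%:R)) <= D / 2.
    have -> : (size p)%:R * (D / (2 * N%:R)) = D / 2 * ((size p)%:R / N%:R).
      by field; rewrite gt_eqF.
    apply: ler_piMr; first by rewrite ltW// divr_gt0.
    by rewrite ler_pdivrMr// mul1r ler_nat leqnSn.
  lra.
have us : uniq s := undup_uniq _.
have uS : u \in s by rewrite mem_undup.
have const_sum (t : R) : (size s)%:R * t = \sum_(z <- s) t.
  by rewrite big_const_seq count_predT iter_addr addr0 mulr_natl.
have low : (size s)%:R * a + (c - a) <= \sum_(z <- s) eta z.
  rewrite const_sum (bigD1_seq u)//= [leRHS](bigD1_seq u)//=.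
  have : \sum_(z <- s | z != u) a <= \sum_(z <- s | z != u) eta z.
    rewrite big_seq_cond [leRHS]big_seq_cond; apply: ler_sum => z /andP[zs _].
    by apply: ha; rewrite mem_undup in zs.
  lra.
have upp : \sum_(z <- s) eta' z <= (size s)%:R * (eta' y + D).
  rewrite const_sum.
  rewrite big_seq [leRHS]big_seq; apply: ler_sum => z zs.
  by apply: close; rewrite mem_undup in zs.
have sN : (size s)%:R <= N%:R :> R by rewrite ler_nat size_undup.
have s0 : 0 < (size s)%:R :> R by rewrite ltr0n; case: (s) uS.
have DE : c - a = 2 * N%:R * D by rewrite /D mulrC divfK// gt_eqF// mulr_gt0.
rewrite -tot in low; rewrite -(ler_pM2l s0).
have : (size s)%:R * D <= N%:R * D by rewrite ler_pM2r.
have := le_trans low upp; rewrite DE !mulrDr.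
have -> : 2 * N%:R * D = N%:R * D + N%:R * D by ring.
lra.
Qed.

(** * Treating a finite list of nodes in turn *)

Section Greedy.
Variables (v0 : V) (W : seq V) (v u : nat -> V) (f : nat -> nat).
Hypotheses (Wpath : path adjb v0 W) (Wlast : last v0 W = v 0%N).
Hypothesis v_adj : forall n, adj G (v n) (v n.+1).
Hypothesis u_inj : injective u.
Hypothesis uv_neq : forall m n, u m <> v n.
Hypothesis u_adj : forall n, adj G (u n) (v (f n)).

(** The walk from [v0] to [v m], without its start; indices begin at 1 because [W] is assumed to
    lead to [v 0]. *)
Definition core (m : nat) : seq V := W ++ [seq v i | i <- iota 1 m].

Lemma core_path m : path adjb v0 (core m).
Proof.
rewrite cat_path Wpath Wlast /=.
elim: m 0%N => //= m IH k; rewrite IH andbT; apply/asboolP; exact: v_adj.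
Qed.

Lemma core_last m : last v0 (core m) = v m.
Proof.
rewrite last_cat Wlast last_map; congr v.
rewrite -[RHS]add0n; elim: m 0%N => [|m IH] k /=; first by rewrite addn0.
by rewrite IH addSnnS.
Qed.

Lemma core_sub m n : (m <= n)%N -> {subset v0 :: core m <= v0 :: core n}.
Proof.
move=> mn y; rewrite !inE !mem_cat => /or3P[->//|->|/mapP[i]]; first by rewrite orbT.
rewrite mem_iota => im ->; rewrite map_f ?orbT// mem_iota; lia.
Qed.

Lemma u_notin_core n m : u n \notin v0 :: W -> u n \notin v0 :: core m.
Proof.
rewrite !inE !mem_cat !negb_or => /andP[-> ->]/=.
by apply/mapP => -[i _]; exact: uv_neq.
Qed.

(* The factor 2 absorbs the error of approximate equalization. *)
Definition share (n : nat) : R := (2 * (size W + f n + 2)%:R)^-1.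

Lemma share_itv n : 0 <= share n <= 1.
Proof.
rewrite /share invr_ge0 mulr_ge0//= invf_le1 ?mulr_gt0 ?ltr0n ?addn2//.
by rewrite -natrM ler1n.
Qed.

(* The nodes are treated from the farthest to the nearest: then the set on which
   the lower bound [a] is needed only shrinks. *)
Lemma greedy_level (ns : seq nat) (a c : R) eta :
  uniq ns -> sorted (fun i j => f j <= f i)%N ns ->
  (forall n, n \in ns -> u n \notin v0 :: W) -> a < c ->
  a <= eta v0 ->
  (forall n y, n \in ns -> y \in v0 :: core (f n) -> a <= eta y) ->
  (forall n, n \in ns -> c <= eta (u n)) ->
  exists ms : seq (move R G),
    c - (c - a) * \prod_(n <- ns) (1 - share n) <= profile_after eta ms v0.
Proof.
elim: ns a eta => [|n ns IH] a eta.
  move=> _ _ _ ac av _ _; exists [::]; rewrite big_nil /=; lra.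
move=> /= /andP[nns uns] sns uW ac av ha hc.
pose p := rcons (core (f n)) (u n).
have [|||||ms [off up]] := @raise_path v0 p (u n) a c eta.
- rewrite rcons_path core_path core_last; apply/asboolP/adj_sym; exact: u_adj.
- by rewrite inE mem_rcons mem_head orbT.
- exact: ac.
- move=> y; rewrite -rcons_cons mem_rcons inE => /predU1P[->|].
    by rewrite (le_trans (ltW ac))// hc// mem_head.
  by apply: ha; exact: mem_head.
- by rewrite hc// mem_head.
set a' := a + _ in up.
have a'E : a' = a + (c - a) * share n.
  rewrite /a' /share /p /= size_rcons /core size_cat size_map size_iota.
  by rewrite addn2.
have share0 : 0 <= share n by have /andP[] := share_itv n.
(* Strictness keeps [a' < c], as the induction hypothesis requires. *)
have share1 : share n < 1.
  rewrite /share invf_lt1 ?mulr_gt0 ?ltr0n ?addn2//.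
  by rewrite -natrM ltr1n.
have c1 : c - a' = (c - a) * (1 - share n) by rewrite a'E; ring.
have p1 : 0 < (c - a) * (1 - share n) by rewrite mulr_gt0// subr_gt0.
have /allP fle : all (fun m => f m <= f n)%N ns.
  by apply: order_path_min sns => i j k; move=> /[swap]; exact: leq_trans.
have a'_le y : y \in v0 :: core (f n) -> a' <= profile_after eta ms y.
  by move=> yc; apply: up; rewrite -rcons_cons mem_rcons inE yc orbT.
have [|k kns||||k kns|ms' ms'P] := IH a' (profile_after eta ms) uns _ _.
- exact: path_sorted sns.
- by apply: uW; rewrite inE kns orbT.
- by rewrite -subr_gt0 c1.
- by apply: a'_le; exact: mem_head.
- move=> m y mns ym; apply: a'_le; exact: core_sub (fle _ mns) _ ym.
(* The remaining nodes lie off the path [p], so the moves just made leave them at level at least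
   [c]. *)
- rewrite off; first by rewrite hc// inE kns orbT.
  rewrite -rcons_cons mem_rcons inE negb_or.
  have kn : k != n by apply: contraNneq nns => <-.
  by rewrite (inj_eq u_inj) kn u_notin_core// uW// inE kns orbT.
exists (ms ++ ms').
by rewrite /profile_after foldl_cat big_cons mulrA -c1.
Qed.

End Greedy.
End Deterministic.

(** * Real products and divergent series *)

Section RealLemmas.
Variable R : realType.

(** Induction with [(1 - x) * (1 + x + S) <= 1 + S]. Hence the product is at most the inverse of [1]
    plus the sum, and tends to 0 when the sums are unbounded. *)
Lemma prod_subr_mul_sum_le1 (x : nat -> R) (s : seq nat) :
  (forall n, 0 <= x n <= 1) ->
  0 <= \prod_(n <- s) (1 - x n) /\
  (\prod_(n <- s) (1 - x n)) * (1 + \sum_(n <- s) x n) <= 1.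
Proof.
move=> x01; elim: s => [|n s [P0 IH]]; first by rewrite !big_nil; lra.
rewrite !big_cons; have /andP[xn0 xn1] := x01 n.
have S0 : 0 <= \sum_(j <- s) x j by apply: sumr_ge0 => j _; have /andP[] := x01 j.
split; first by rewrite mulr_ge0// subr_ge0.
apply: le_trans IH; set Q := \prod_(j <- s) _ in P0 *; set S := \sum_(j <- s) _ in S0 *.
rewrite mulrAC [leRHS]mulrC ler_wpM2r//; nra.
Qed.

(** Contrapositive of the comparison test. The cutoff [m] allows for finitely many indices at which
    [x] is set to 0. *)
Lemma unbounded_series (x y : nat -> R) (k : R) (m : nat) :
  0 < k -> (forall n, 0 <= x n) -> (forall n, 0 <= y n) ->
  (forall n, (m <= n)%N -> y n <= k * x n) -> ~ cvgn (series y) ->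
  forall M : R, exists N, M <= \sum_(0 <= n < N) x n.
Proof.
move=> k0 x0 y0 yx dy M; apply: contrapT => /forallNP bnd.
apply: dy; rewrite -(is_cvg_series_restrict m).
apply: nondecreasing_is_cvgn.
  apply/nondecreasing_seqP => n /=; have [mn|nm] := leqP m n.
    by rewrite big_nat_recr//= lerDl.
  by rewrite !big_geq// ltnW.
exists (k * M) => _ [N _ <-] /=.
have /negP := bnd N; rewrite -ltNge => bN.
apply: le_trans (_ : k * \sum_(0 <= n < N) x n <= _); last first.
  by rewrite ler_wpM2l ?ltW.
have [mN|Nm] := leqP m N; last first.
  by rewrite big_geq ?(ltnW Nm)// mulr_ge0 ?(ltW k0) ?sumr_ge0.
rewrite [in leRHS](@big_cat_nat _ _ _ m)//= mulrDr ler_wpDl ?mulr_ge0 ?sumr_ge0 ?(ltW k0)//.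
rewrite mulr_sumr big_nat_cond [leRHS]big_nat_cond.
by apply: ler_sum => n /andP[/andP[mn _] _]; exact: yx.
Qed.
End RealLemmas.

(** * Random products over independent events *)

Section Thinning.
Context d (Omega : measurableType d) (R : realType) (P : probability Omega R).
Variables (A : nat -> set Omega) (p : R) (x : nat -> R).
Hypothesis mA : forall n, measurable (A n).
Hypothesis p_gt0 : 0 < p.
Hypothesis indepA : forall s : seq nat, uniq s ->
  P (\bigcap_(n in [set` s]) A n) = (p ^+ size s)%:E.
Hypothesis x01 : forall n, 0 <= x n <= 1.

(** The random factor left on the deficit: index [n] reduces it only when [A n] occurs. *)
Definition thinned (s : seq nat) (w : Omega) : R :=
  \prod_(n <- s) (1 - x n * \1_(A n) w).

Lemma thinned_factor n w : 0 <= 1 - x n * \1_(A n) w.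
Proof.
have /andP[? ?] := x01 n; rewrite indicE.
by case: (_ \in _); rewrite ?mulr1 ?mulr0; lra.
Qed.

Lemma thinned_ge0 s w : 0 <= thinned s w.
Proof. by apply: prodr_ge0 => n _; exact: thinned_factor. Qed.

Lemma measurable_thinned s : measurable_fun setT (thinned s).
Proof.
apply: measurable_prod => n _; apply: measurable_funB => //.
by apply: measurable_funM => //; exact: measurable_indic.
Qed.

(* The extra product of indicators makes the induction go through: splitting off
   a factor [1 - x n 1_(A n)] either drops it or moves [n] to the indicators. *)
Lemma integral_thinned_indic (J K : seq nat) : uniq (J ++ K) ->
  (\int[P]_w (thinned J w * \prod_(n <- K) \1_(A n) w)%:E =
   ((\prod_(n <- J) (1 - x n * p)) * p ^+ size K)%:E)%E.
Proof.
elim: J K => [|n J IH] K /= uJK.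
  rewrite big_nil mul1r -(indepA uJK) bigcap_seq -[X in P X]setIT -integral_indic//.
    apply: eq_integral => w _; rewrite /thinned big_nil mul1r; congr EFin.
    elim: K {uJK} => [|k K IH]; first by rewrite !big_nil indicT.
    by rewrite !big_cons IH indicI.
  exact: bigsetI_measurable.
have mF s t : measurable_fun setT
    (fun w => (thinned s w * \prod_(j <- t) \1_(A j) w)%:E).
  apply/measurable_EFinP/measurable_funM; first exact: measurable_thinned.
  by apply: measurable_prod => j _; exact: measurable_indic.
have F0 s t w : 0 <= thinned s w * \prod_(j <- t) \1_(A j) w.
  by rewrite mulr_ge0 ?thinned_ge0// prodr_ge0.
have /andP[xn0 _] := x01 n.
move: uJK => /andP[nJK uJK].
have uJnK : uniq (J ++ n :: K).
  by rewrite -cat1s uniq_catCA /= nJK.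
have := IH K uJK.
have -> : (\int[P]_w (thinned J w * \prod_(j <- K) \1_(A j) w)%:E =
    \int[P]_w ((thinned (n :: J) w * \prod_(j <- K) \1_(A j) w)%:E +
       (x n)%:E * (thinned J w * \prod_(j <- n :: K) \1_(A j) w)%:E))%E.
  apply: eq_integral => w _; rewrite -EFinM -EFinD; congr EFin.
  by rewrite /thinned !big_cons; ring.
rewrite ge0_integralD//=; last 3 first.
- by move=> w _; rewrite lee_fin.
- by move=> w _; rewrite mule_ge0 ?lee_fin.
- exact: measurable_funeM.
rewrite ge0_integralZl_EFin//; last by move=> w _; rewrite lee_fin.
rewrite (IH _ uJnK) -EFinM big_cons /= exprS.
(* The unknown integral plus a finite term is finite, which excludes infinite values and permits
   cancellation. *)
by case: integral => [r| |]//; rewrite -EFinD => -[rE]; congr EFin; lra.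
Qed.

Lemma integral_thinned (s : seq nat) : uniq s ->
  (\int[P]_w (thinned s w)%:E = (\prod_(n <- s) (1 - x n * p))%:E)%E.
Proof.
move=> us; have := @integral_thinned_indic s [::]; rewrite cats0 expr0 mulr1.
by move=> /(_ us) <-; apply: eq_integral => w _; rewrite big_nil mulr1.
Qed.

Hypothesis x_unbounded : forall M : R, exists N, M <= \sum_(0 <= n < N) x n.

(** Markov's inequality: if [q] is the probability that the product stays at least [t] for every
    [N], then [t * q] is at most each expectation [\prod (1 - x n * p)], and these tend to 0. *)
Lemma thinned_small_ae (t : R) : 0 < t ->
  {ae P, forall w, exists N, thinned (iota 0 N) w < t}.
Proof.
move=> t0; pose B N := [set w | t <= thinned (iota 0 N) w].
have mB N : measurable (B N).
  have -> : B N = setT `&` thinned (iota 0 N) @^-1` `[t, +oo[%classic.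
    by rewrite setTI; apply/seteqP; split=> w /=; rewrite in_itv/= andbT.
  by apply: measurable_thinned => //; exact: measurable_itv.
have mBI : measurable (\bigcap_N B N) by exact: bigcapT_measurable.
exists (\bigcap_N B N); split=> //; last first.
  by move=> w /= /forallNP nw N _ /=; rewrite /B /= leNgt; apply/negP/nw.
have bound N : (t%:E * P (\bigcap_N B N) <= (\prod_(n <- iota 0 N) (1 - x n * p))%:E)%E.
  rewrite -integral_thinned ?iota_uniq// -[X in P X]setIT -integral_indic//.
  rewrite -ge0_integralZl_EFin//; [|exact/measurable_EFinP/measurable_indic|exact: ltW].
  apply: ge0_le_integral => //=.
  - by move=> w _; rewrite -EFinM lee_fin mulr_ge0// ltW.
  - by apply/measurable_funeM/measurable_EFinP/measurable_indic.
  - exact/measurable_EFinP/measurable_thinned.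
  move=> w _; rewrite -EFinM lee_fin indicE.
  case: (boolP (_ \in _)) => [|_]; last by rewrite mulr0 thinned_ge0.
  by rewrite inE => /(_ N I); rewrite mulr1.
have [p1 q0 qfin] : [/\ p <= 1, (0 <= P (\bigcap_N B N))%E &
    P (\bigcap_N B N) \is a fin_num].
  split=> //; last exact: fin_num_measure.
  (* A one-element intersection has probability [p], whence [p <= 1]. *)
  have : (P (\bigcap_(n in [set` [:: 0%N]]) A n) <= 1)%E.
    by apply: probability_le1; rewrite bigcap_seq; exact: bigsetI_measurable.
  by rewrite indepA//= lee_fin expr1.
move: (P _) q0 qfin bound => [q| |]// + _ bound; rewrite lee_fin le_eqVlt.
move=> /predU1P[<-//|q0]; exfalso.
(* For this [N], [t * q] times the sum of the [x n * p] is at least 1, so [t * q * (1 + sum) > 1],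
   against [prod_subr_mul_sum_le1]. *)
have [N] := x_unbounded (t * q * p)^-1.
rewrite -(@ler_pM2l _ (t * q * p)) ?mulr_gt0// mulfV ?gt_eqF ?mulr_gt0// => SN.
have xp01 n : 0 <= x n * p <= 1.
  by have /andP[? ?] := x01 n; rewrite mulr_ge0 ?mulr_ile1 ?(ltW p_gt0).
have [_] := prod_subr_mul_sum_le1 (iota 0 N) xp01.
have := bound N; rewrite -EFinM lee_fin => tq.
have S0 : 0 <= \sum_(n <- iota 0 N) x n * p.
  by apply: sumr_ge0 => n _; have /andP[] := xp01 n.
have : t * q * (1 + \sum_(n <- iota 0 N) x n * p) <=
    \prod_(n <- iota 0 N) (1 - x n * p) * (1 + \sum_(n <- iota 0 N) x n * p).
  by rewrite ler_wpM2r// addr_ge0.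
rewrite /index_iota subn0 in SN.
rewrite -mulr_suml; set S := \sum_(n <- iota 0 N) x n in SN *; set D := \prod_(_ <- _) _.
have tq0 : 0 < t * q by rewrite mulr_gt0.
nra.
Qed.

End Thinning.

(** * Walks, countability and bounds on levels *)

Section Graph.
Variables (V : choiceType) (G : simple_graph V).

Lemma connected_walk (x y : V) : connected_graph G ->
  exists2 W : seq V, path (adjb G) x W & last x W = y.
Proof.
move=> /(_ x y); elim=> {x y} [x y xy|x|x y z _ [W1 p1 l1] _ [W2 p2 l2]].
- by exists [:: y] => //=; rewrite andbT; apply/asboolP.
- by exists [::].
- by exists (W1 ++ W2); rewrite ?cat_path ?last_cat ?l1 ?p1.
Qed.

(** Here [sphere n] collects the endpoints of walks of length [n] from [x]. Countability lets a
    single null event serve all vertices. *)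
Lemma countable_vertices (x : V) :
  connected_graph G -> bounded_degree G -> countable [set: V].
Proof.
move=> Gconn [D degD].
pose sphere := fix sphere n := if n is n.+1 then
  \bigcup_(y in sphere n) [set z | adj G y z] else [set x].
have -> : [set: V] = \bigcup_n sphere n.
  apply/seteqP; split=> // y _.
  have := clos_rt_rtn1 _ _ _ _ (Gconn x y); elim=> [|z t zt _ [n _ nz]].
    by exists 0%N.
  by exists n.+1 => //; exists z.
apply: bigcup_countable => // n _; elim: n => [|n IH]; first exact: countable1.
apply: bigcup_countable => // y _; apply: finite_set_countable.
exact: card_le_finite (degD y) (finite_II D).
Qed.

Lemma injective_notin (u : nat -> V) (s : seq V) : injective u ->
  exists m, forall n, (m <= n)%N -> u n \notin s.
Proof.
move=> u_inj; elim: s => [|y s [m mP]]; first by exists 0%N.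
have [[k uk]|nuk] := pselect (exists k, u k = y).
  exists (maxn m k.+1) => n; rewrite geq_max => /andP[mn kn].
  rewrite inE negb_or mP// andbT -uk (inj_eq u_inj); lia.
exists m => n mn; rewrite inE negb_or mP// andbT.
by apply/eqP => uy; apply: nuk; exists n.
Qed.

Lemma profile_after_itv (R : realType) (eta : V -> R) (ms : seq (move R G)) :
  (forall y, 0 <= eta y <= 1) -> forall y, 0 <= profile_after eta ms y <= 1.
Proof.
elim: ms eta => [//|m ms IH] eta eta01 /=; apply: IH => y.
have /andP[m0 m1] := move_coef_itv m; rewrite /apply_move.
have /andP[? ?] := eta01 (move_fst m); have /andP[? ?] := eta01 (move_snd m).
by do 2?case: ifP => _ //; apply/andP; split; nra.
Qed.

Lemma kappa_eq1 (R : realType) (eta : V -> R) (v : V) :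
  (forall y, 0 <= eta y <= 1) ->
  (forall e, 0 < e -> exists ms : seq (move R G), 1 - e <= profile_after eta ms v) ->
  kappa G eta v = 1%:E.
Proof.
move=> eta01 high; apply/eqP; rewrite eq_le; apply/andP; split.
  apply: ge_ereal_sup => _ [_ [_ [ms <-]] <-]; rewrite lee_fin.
  by have /andP[] := profile_after_itv ms eta01 v.
apply/lee_addgt0Pr => e e0; have [ms hms] := high e e0.
apply: (@le_trans _ _ ((profile_after eta ms v)%:E + e%:E)%E).
  by rewrite -EFinD lee_fin; lra.
rewrite leeD2r//; apply: ereal_sup_ubound; exists (profile_after eta ms v) => //.
by split; [have /andP[] := profile_after_itv ms eta01 v|exists ms].
Qed.

End Graph.

(** * Uniform levels and independence along the nodes *)

Section Probability.
Context d (Omega : measurableType d) (R : realType) (P : probability Omega R).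

Lemma uniform01_itv (X : {RV P >-> R}) (c : R) : uniform01 X -> 0 <= c < 1 ->
  P (X @^-1` `[c, 1]%classic) = (1 - c)%:E.
Proof.
move=> uX /andP[c0 c1].
rewrite -[LHS]/(distribution P X `[c, 1]%classic) uX; last exact: measurable_itv.
rewrite /uniform_prob integral_uniform_pdf setIidl; last first.
  by move=> z /=; rewrite !in_itv/= => /andP[cz ->]; rewrite (le_trans c0).
rewrite (eq_integral (cst 1%E)); last first.
  move=> z; rewrite inE/= in_itv/= => /andP[cz z1].
  by rewrite /uniform_pdf (le_trans c0 cz) z1 subr0 invr1.
by rewrite integral_cst//= lebesgue_measure_itv/= lte_fin c1 mul1e.
Qed.

Lemma independent_RVs_same_prob (I : choiceType) (X : I -> {RV P >-> R})
    (u : nat -> I) (B : set R) (p : R) :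
  independent_RVs X -> injective u -> measurable B ->
  (forall n, P (X (u n) @^-1` B) = p%:E) ->
  forall s : seq nat, uniq s ->
    P (\bigcap_(n in [set` s]) X (u n) @^-1` B) = (p ^+ size s)%:E.
Proof.
move=> indep u_inj mB PB s us.
have := indep [fset i in map u s]%fset (fun=> B) (fun _ _ => mB).
have -> : \bigcap_(i in [set` [fset i in map u s]%fset]) X i @^-1` B =
    \bigcap_(n in [set` s]) X (u n) @^-1` B.
  apply/seteqP; split=> w h i /=.
    by move=> si; apply: h; rewrite /= inE map_f.
  by rewrite !inE => /mapP[n ns ->]; exact: h.
move=> ->; rewrite (perm_big (map u s))/=; last first.
  apply: uniq_perm; rewrite ?fset_uniq ?map_inj_uniq// => i.
  by rewrite inE.
rewrite big_map {us}; elim: s => [|n s IH]; first by rewrite big_nil.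
by rewrite big_cons IH PB -EFinM -exprS.
Qed.

End Probability.

(** * From random nodes to a level at the target vertex *)

Section Level.
Variables (R : realType) (V : choiceType) (G : simple_graph V).
Variables (v0 : V) (W : seq V) (v u : nat -> V) (f : nat -> nat).
Hypothesis u_inj : injective u.

(** Nodes on the walk to the half-line could be altered while others are treated, so they are
    discarded; they are finitely many. *)
Definition weight (n : nat) : R :=
  if u n \in v0 :: W then 0 else share R W f n.

Lemma weight_itv n : 0 <= weight n <= 1.
Proof. by rewrite /weight; case: ifP => _; rewrite ?lexx ?ler01 ?share_itv. Qed.

Lemma weight_unbounded : ~ cvgn (series (fun n => (f n).+1%:R^-1 : R)) ->
  forall M : R, exists N, M <= \sum_(0 <= n < N) weight n.
Proof.
have [m mP] := injective_notin (v0 :: W) u_inj.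
(* The constant comes from [size W + f n + 2 <= (size W + 2) * (f n + 1)]. *)
apply: (@unbounded_series _ _ _ (2 * (size W + 2))%:R m) => // [n|n mn].
  by have /andP[] := weight_itv n.
rewrite /weight (negbTE (mP _ mn)) /share.
rewrite -natrM ler_pdivlMr ?ltr0n ?addn2// mulrC ler_pdivrMr ?ltr0n//.
rewrite -natrM ler_nat; nia.
Qed.

Hypotheses (Wpath : path (adjb G) v0 W) (Wlast : last v0 W = v 0%N).
Hypothesis v_adj : forall n, adj G (v n) (v n.+1).
Hypothesis uv_neq : forall m n, u m <> v n.
Hypothesis u_adj : forall n, adj G (u n) (v (f n)).

(** [greedy_level] from [a = 0], applied to the good nodes off the walk sorted by decreasing [f];
    every other index contributes a factor 1. *)
Lemma level_thinned (eta : V -> R) (good : pred nat) (c : R) (N : nat) :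
  (forall y, 0 <= eta y) -> 0 < c -> (forall n, good n -> c <= eta (u n)) ->
  exists ms : seq (move R G),
    c - c * \prod_(n <- iota 0 N) (1 - weight n * (good n)%:R)
      <= profile_after eta ms v0.
Proof.
move=> eta0 c0 goodP.
pose ns := [seq n <- iota 0 N | good n && (u n \notin v0 :: W)].
pose leF := (fun i j => f j <= f i)%N.
have nsP n : n \in sort leF ns -> good n /\ u n \notin v0 :: W.
  by rewrite mem_sort mem_filter => /andP[/andP[]].
have [|||||||ms msP] := @greedy_level R V G v0 W v u f Wpath Wlast v_adj u_inj
    uv_neq u_adj (sort leF ns) 0 c eta.
- by rewrite sort_uniq filter_uniq ?iota_uniq.
- by apply: sort_sorted => i j; exact: leq_total.
- by move=> n /nsP[].
- exact: c0.
- exact: eta0.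
- by move=> n y _ _; exact: eta0.
- by move=> n /nsP[/goodP].
exists ms; apply: le_trans msP; rewrite subr0 le_eqVlt; apply/orP; left; apply/eqP.
congr (_ - _ * _); rewrite [RHS](perm_big ns) ?perm_sort// /ns big_filter [RHS]big_mkcond /=.
apply: eq_bigr => n _; rewrite /weight.
by case: (good n); case: (u n \in _); rewrite ?mulr1 ?mulr0 ?subr0.
Qed.

End Level.

(** * Almost sure conclusion *)

Theorem theorem3p3 (R : realType) (V : choiceType) (G : simple_graph V)
    (Ginf : infinite_set [set: V]) (Gconn : connected_graph G)
    (Gdeg : bounded_degree G)
    (d : measure_display) (Omega : measurableType d) (P : probability Omega R)
    (eta0 : V -> {RV P >-> R})
    (eta0_indep : independent_RVs eta0)
    (eta0_unif : forall u, uniform01 (eta0 u))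
    (v : V) :
  has_neighbor_rich_half_line R G ->
  {ae P, forall w, kappa G (fun u => eta0 u w) v = 1%:E}.
Proof.
move=> [h [u [f [[h_inj h_adj] [u_inj uh] f_inj u_adj dvg]]]].
have [W Wpath Wlast] := connected_walk v (h 0%N) Gconn.
pose A (c : R) n := eta0 (u n) @^-1` `[c, 1]%classic.
pose x := weight R v W u f.
(* The threshold [1 - 1 / (k + 2)] lies strictly between 0 and 1, and a node reaches it with
   probability [1 / (k + 2)]. Countably many pairs [k], [j] suffice, so the null events can be
   united. *)
have small k j : {ae P, forall w, exists N,
    thinned (A (1 - k.+2%:R^-1)) x (iota 0 N) w < j.+1%:R^-1}.
  have k1 : 0 <= (1 - k.+2%:R^-1 : R) < 1.
    by rewrite subr_ge0 gtrBl invr_gt0 ltr0n invf_le1 ?ltr0n// ler1n.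
  apply: (@thinned_small_ae _ _ _ _ _ k.+2%:R^-1) => //.
  - by move=> n; apply: measurable_funPTI; exact: measurable_itv.
  - apply: independent_RVs_same_prob => // n.
    by rewrite uniform01_itv//; congr EFin; ring.
  - by move=> n; exact: weight_itv.
  - exact: weight_unbounded.
have range01 : {ae P, forall w, forall y, 0 <= eta0 y w <= 1}.
  have /countable_injP[g g_inj] := countable_vertices v Gconn Gdeg.
  (* Vertices are indexed by their code under the injection [g], which turns the statement into a
     countable one. *)
  have : {ae P, forall w, forall n, forall y, g y = n -> 0 <= eta0 y w <= 1}.
    apply: ae_foralln => n.
    have [[y gy]|ng] := pselect (exists y, g y = n); last first.
      by apply: aeW => w y gy; exfalso; apply: ng; exists y.
    have mE : measurable (eta0 y @^-1` `[0, 1]%classic).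
      by apply: measurable_funPTI; exact: measurable_itv.
    exists (~` (eta0 y @^-1` `[0, 1]%classic)); split.
    - exact: measurableC.
    - apply: etrans (probability_setC P mE) _.
      by rewrite uniform01_itv ?lexx ?ltr01// subr0 subee.
    - move=> w /= nw ew; apply: nw => y' gy'.
      by have -> : y' = y by apply: g_inj; rewrite ?inE// gy' gy.
  by apply: filterS => w hw y; exact: hw.
have small' := ae_foralln (fun k => ae_foralln (small k)).
apply: filterS2 range01 small' => w w01 wsmall.
apply: kappa_eq1 => // e e0.
(* The same [k] bounds both losses by [e / 2]: the distance of the threshold from 1 and the
   remaining factor on the deficit. *)
have [k ke] : exists k : nat, k.+1%:R^-1 <= e / 2.
  exists (Num.truncn (e / 2)^-1); rewrite invf_ple ?posrE ?divr_gt0//.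
  exact/ltW/truncnS_gt.
have [N Nsmall] := wsmall k k.
have k2 : 0 < 1 - k.+2%:R^-1 :> R by rewrite subr_gt0 invf_lt1 ?ltr0n// ltr1n.
have [|||ms msP] := @level_thinned R V G v W h u f u_inj Wpath Wlast h_adj uh u_adj
    (fun y => eta0 y w) (fun n => w \in A (1 - k.+2%:R^-1) n) (1 - k.+2%:R^-1) N.
- by move=> y; have /andP[] := w01 y.
- exact: k2.
- by move=> n; rewrite inE /A /= in_itv/= => /andP[].
exists ms; apply: le_trans msP.
have -> : \prod_(n <- iota 0 N) (1 - weight R v W u f n *
    (w \in A (1 - k.+2%:R^-1) n)%:R) = thinned (A (1 - k.+2%:R^-1)) x (iota 0 N) w.
  by apply: eq_bigr => n _; rewrite indicE.
have kk : k.+2%:R^-1 <= k.+1%:R^-1 :> R by rewrite lef_pV2 ?posrE ?ltr0n// ler_nat.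
have k20 : 0 < k.+2%:R^-1 :> R by rewrite invr_gt0 ltr0n.
have T0 : 0 <= thinned (A (1 - k.+2%:R^-1)) x (iota 0 N) w.
  by apply: thinned_ge0 => n; exact: weight_itv.
set T := thinned _ _ _ _ in Nsmall T0 *; set a := k.+2%:R^-1 in kk k20 k2 *.
set b := k.+1%:R^-1 in ke kk Nsmall.
nra.
Qed.
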